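(* Let $X$ be a random variable taking values in $\mathbb{N}_0$ with $\lambda=\mathbb{E}[X]\in(0,\infty)$. Assume there exists a $\mathbb{Z}$-valued random variable $Z$ on the same probability space as $X$ such that $$ i\,\mathbb{P}(X=i)=\lambda\,\mathbb{P}(X+Z=i-1),\qquad i\in\mathbb{N}. $$ (a) If $Z$ is non-negative, then $\mathbb{P}(X=0)\ge e^{-\lambda}$. (b) If $Z$ is non-positive, then $\mathbb{P}(X=0)\le e^{-\lambda}$.
   Context: $\mathbb{N}=\{1,2,\dots\}$ and $\mathbb{N}_0=\mathbb{N}\cup\{0\}$. *)

(* Defs.v *)
From HB Require Import structures.
From mathcomp Require Import all_boot all_order all_algebra.
From mathcomp Require Import all_classical all_reals all_analysis.

Set Implicit Arguments.
Unset Strict Implicit.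
Unset Printing Implicit Defensive.

(* The integers carry the discrete sigma-algebra (all subsets), exactly as the
   library does for nat; thus {RV P >-> int} is the type of Z-valued random
   variables. *)
HB.instance Definition _ := isPointed.Build int 0%R.
HB.instance Definition _ := @isMeasurable.Build default_measure_display
  int (@discrete_measurable int) (@discrete_measurable0 int)
  (@discrete_measurableC int) (@discrete_measurableU int).

(* Main.v *)
Require Import Defs.
From HB Require Import structures.
From mathcomp Require Import all_boot all_order all_algebra.
From mathcomp Require Import all_classical all_reals all_analysis.
From mathcomp Require Import zify ring lra.
Import Order.TTheory GRing.Theory Num.Theory.
Import numFieldNormedType.Exports.

(** Write [p i = P (X = i)] and [q i = P (X + Z = i)], so that the hypothesis
    reads [(i + 1) p (i + 1) = lambda q i]: the generating function [G] of [X]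
    satisfies [G' = lambda H] on [[0, 1]], where [H s] is the sum of the
    [q i s^i]. When [Z >= 0] the variable [X + Z] dominates [X], hence
    [H <= G] and [G' <= lambda G]; so [e^(- lambda s) G s] decreases and
    [e^(- lambda) = e^(- lambda) G 1 <= G 0 = P (X = 0)]. When [Z <= 0] all
    these inequalities are reversed.

    To avoid differentiating a power series, the argument is run on the
    polynomials [G n] of degree at most [n] truncating [G], and [n] goes to
    infinity at the end. The differential inequality is integrated in
    [horner_gronwall]. The comparison of [H] with [G] uses only the distribution
    functions: by summation by parts ([power_sum_le]), inequalities between
    partial sums of coefficients pass to the values of the polynomials on
    [[0, 1]]. Truncation is harmless when [G n' <= lambda G (n - 1)], as
    [G (n - 1) <= G n]; in the other direction it leaves an error [p n], which
    is absorbed by shifting the polynomial by the constant [p n], and tends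
    to 0.

    For [Z <= 0] the variable [X + Z] might be negative, and the inclusion of
    [X < n] in [X + Z < n] controls the partial sums of the [q i] only if
    [P (X + Z < 0) = 0]. This is where [lambda = E X] enters: summing the
    recursion over all [i] gives [E X = lambda P (X + Z >= 0)]. *)

Local Open Scope classical_set_scope.
Local Open Scope ring_scope.

(** The derivative of [e^(- lambda s) p s] is
    [e^(- lambda s) (p' s - lambda p s)], which is nonpositive. *)
Lemma horner_gronwall (R : realType) (lambda : R) (p : {poly R}) :
  (forall s, 0 <= s <= 1 -> p^`().[s] <= lambda * p.[s]) ->
  expR (- lambda) * p.[1] <= p.[0].
Proof.
move=> dp.
pose f (s : R) := expR (- lambda * s) * p.[s].
have fD (s : R) : is_derive s (1 : R) f
    (expR (- lambda * s) * (p^`().[s] - lambda * p.[s])).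
  have dlin : is_derive s (1 : R) ( *%R (- lambda)) (- lambda).
    have := @is_deriveZ _ _ _ id (- lambda) s 1 1 _.
    by rewrite /GRing.scale /= mulr1; apply.
  have := is_deriveM (is_derive1_comp (is_derive_expR (- lambda * s)) dlin)
    (is_derive_poly p s).
  congr (is_derive _ _ _ _).
  rewrite /GRing.scale /=; ring.
suff : f 1 <= f 0 by rewrite /f mulr1 mulr0 expR0 mul1r.
apply: (@ler0_derive1_le_cc _ f 0 1); rewrite ?in_itv/= ?lexx ?ler01//.
- move=> s; rewrite in_itv /= => /andP[s0 s1].
  rewrite derive1E (@derive_val _ _ _ _ _ _ _ (fD s)) pmulr_rle0 ?expR_gt0// subr_le0.
  by apply: dp; rewrite !ltW.
- by apply: derivable_within_continuous => s _; case: (fD s).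
Qed.

(** Summation by parts: the sum is a combination of the partial sums of [c] with
    the nonnegative weights [s^i - s^(i+1)] and a power of [s]. *)
Lemma power_sum_ge0 (R : realFieldType) (c : nat -> R) (s : R) (n : nat) :
  0 <= s <= 1 -> (forall k, 0 <= \sum_(i < k) c i) ->
  0 <= \sum_(i < n) c i * s ^+ i.
Proof.
move=> /andP[s0 s1] c0.
(* The stronger bound carries the last term of the summation by parts, which
   is what makes the induction go through. *)
suff h : s ^+ n * (\sum_(i < n) c i) <= \sum_(i < n) c i * s ^+ i.
  by apply: le_trans h; rewrite mulr_ge0 ?exprn_ge0 ?c0.
elim: n => [|n IHn]; first by rewrite !big_ord0 mulr0.
rewrite [leRHS]big_ord_recr /=.
apply: (@le_trans _ _ (s ^+ n * \sum_(i < n.+1) c i)).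
  by rewrite exprS; apply: ler_wpM2r => [|]; [exact: c0|rewrite ler_piMl ?exprn_ge0].
by rewrite big_ord_recr /= mulrDr [_ * c n]mulrC lerD2r.
Qed.

Lemma power_sum_le (R : realFieldType) (a b : nat -> R) (s : R) (n : nat) :
  0 <= s <= 1 ->
  (forall k, \sum_(i < k) a i <= \sum_(i < k) b i) ->
  \sum_(i < n) a i * s ^+ i <= \sum_(i < n) b i * s ^+ i.
Proof.
move=> s01 ab; rewrite -subr_ge0 -sumrB.
under eq_bigr do rewrite -mulrBl.
apply: (@power_sum_ge0 _ (fun i => b i - a i)) => // k.
by rewrite sumrB subr_ge0.
Qed.

Section recursion.
Context (R : realType) (lambda : R) (p q : nat -> R).
Context (lambda_gt0 : 0 < lambda) (p_ge0 : forall i, 0 <= p i).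
Context (pq : forall i, i.+1%:R * p i.+1 = lambda * q i).
Context (p_sum1 : (fun n => \sum_(i < n) p i) @ \oo --> (1 : R)).

(** The degree bound is [n], hence [n.+1] coefficients; then [dG] involves
    exactly the first [n] values of [q]. *)
Let G n := \poly_(i < n.+1) p i.

Let G0 n : (G n).[0] = p 0%N.
Proof. by rewrite horner_coef0 coef_poly. Qed.

Let G1 n : (G n).[1] = \sum_(i < n.+1) p i.
Proof.
by rewrite horner_poly; apply: eq_bigr => i _; rewrite expr1n mulr1.
Qed.

Let dG n s : (G n)^`().[s] = lambda * \sum_(i < n) q i * s ^+ i.
Proof.
rewrite (@horner_coef_wide _ n); last first.
  apply: leq_trans (size_poly _ _) _.
  by have := size_poly n.+1 p; rewrite -/(G n); case: (size _).
rewrite mulr_sumr; apply: eq_bigr => i _.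
by rewrite coef_deriv coef_poly ltnS ltn_ord -mulr_natl pq mulrA.
Qed.

Let p_sumS1 : (fun n => \sum_(i < n.+1) p i) @ \oo --> (1 : R).
Proof. by have := p_sum1; rewrite -cvg_shiftS. Qed.

Let p_cvg0 : p @ \oo --> (0 : R).
Proof.
have -> : p = (fun n => \sum_(i < n.+1) p i) - (fun n => \sum_(i < n) p i).
  by apply/funext => n; rewrite !fctE big_ord_recr /= addrC addKr.
by rewrite -[X in _ --> X](subrr 1); exact: cvgB.
Qed.

(** Here [G n' s <= lambda (G n s - p n s^n) <= lambda G n s], so the Gronwall
    bound applies to [G n] itself. *)
Lemma expRN_le_pmf0 :
  (forall n, \sum_(i < n) q i <= \sum_(i < n) p i) -> expR (- lambda) <= p 0%N.
Proof.
move=> qp; rewrite -[leLHS]mulr1.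
apply: (ler_cvg_to (cvgM (cvg_cst (expR (- lambda))) p_sumS1)
  (cvg_cst (p 0%N))).
near=> n; have := horner_gronwall _ lambda (G n).
rewrite G0 G1; apply => s s01.
rewrite dG ler_pM2l// (le_trans (power_sum_le _ _ _ _ n s01 qp))//.
rewrite horner_poly big_ord_recr /= lerDl mulr_ge0 ?exprn_ge0//.
by case/andP: s01.
Unshelve. all: by end_near. Qed.

(** Here [G n' s >= lambda (G n s - p n s^n) >= lambda (G n s - p n)], since
    [s^n <= 1]; so the Gronwall bound applies to the polynomial [p n - G n]. *)
Lemma pmf0_le_expRN :
  (forall n, \sum_(i < n) p i <= \sum_(i < n) q i) -> p 0%N <= expR (- lambda).
Proof.
move=> qp; rewrite -[leRHS]mulr1 -[leLHS]subr0 -[X in _ * X]subr0.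
apply: (ler_cvg_to (cvgB (cvg_cst (p 0%N)) p_cvg0)
  (cvgM (cvg_cst (expR (- lambda))) (cvgB p_sumS1 p_cvg0))).
near=> n; rewrite !fctE.
have := horner_gronwall _ lambda ((p n)%:P - G n).
rewrite !hornerE G0 G1 => h.
suff: expR (- lambda) * (p n - \sum_(i < n.+1) p i) <= p n - p 0%N.
  by rewrite -lerN2 -mulrN !opprB.
apply: h => s s01; rewrite derivB derivC !hornerE dG horner_poly.
have [s0 s1] := andP s01.
rewrite -mulrN ler_pM2l// lerBrDr addrC -lerBrDr opprK big_ord_recr /=.
have := power_sum_le _ _ _ _ n s01 qp.
have : p n * s ^+ n <= p n by rewrite ler_piMr// exprn_ile1.
lra.
Unshelve. all: by end_near. Qed.

End recursion.

Section integer_events.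
Context d (T : measurableType d) (R : realType) (P : probability T R).

Lemma trivIset_fiber (U : Type) (f : T -> U) (g : nat -> U) :
  injective g -> trivIset setT (fun i => [set t | f t = g i]).
Proof.
move=> g_inj i j _ _ [t /= [fi fj]]; apply: g_inj.
by rewrite -fi -fj.
Qed.

Context (Y : T -> int) (mY : forall k, measurable [set t | Y t = k]).

Let triv : trivIset setT (fun i : nat => [set t | Y t = i%:Z]).
Proof. by apply: trivIset_fiber => i j []. Qed.

Let level_lt (n : nat) :
  [set t | 0 <= Y t < n%:Z] = \bigcup_(i < n) [set t | Y t = i%:Z].
Proof.
apply/seteqP; split => [t /=|t [i /= ltin ->//]].
by case E: (Y t) => [i|//]; rewrite ltz_nat => /andP[_ lin]; exists i.
Qed.

Let level_ge0 : [set t | 0 <= Y t] = \bigcup_i [set t | Y t = i%:Z].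
Proof.
apply/seteqP; split => [t /=|t [i _ /= ->]//].
by case E: (Y t) => [i|//] _; exists i.
Qed.

Lemma sum_prob_eq (n : nat) :
  \sum_(i < n) fine (P [set t | Y t = i%:Z]) =
  fine (P [set t | 0 <= Y t < n%:Z]).
Proof.
rewrite level_lt bigcup_mkord.
rewrite (measure_bigsetU P (fun i : nat => mY i%:Z) triv).
rewrite -[LHS]/(fine (_ %:E)) -sumEFin; congr fine; apply: eq_bigr => i _.
by rewrite fineK// fin_num_measure.
Qed.

Lemma series_prob_eq :
  (\sum_(0 <= i <oo) P [set t | Y t = i%:Z] = P [set t | (0 <= Y t)%R])%E.
Proof.
rewrite level_ge0 measure_semi_bigcup//.
by apply: bigcup_measurable => i _; exact: mY.
Qed.

Lemma cvg_sum_prob_eq : P [set t | 0 <= Y t] = 1%E ->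
  (fun n => \sum_(i < n) fine (P [set t | Y t = i%:Z])) @ \oo --> (1 : R).
Proof.
move=> Y1.
have -> : (fun n => \sum_(i < n) fine (P [set t | Y t = i%:Z])) =
    fine \o (fun n => \sum_(0 <= i < n) P [set t | Y t = i%:Z])%E.
  apply/funext => n; rewrite /= big_mkord -[LHS]/(fine (_ %:E)) -sumEFin.
  by congr fine; apply: eq_bigr => i _; rewrite fineK// fin_num_measure.
apply: fine_cvg; rewrite -Y1 level_ge0.
exact: measure_sigma_additive (fun i : nat => mY i%:Z) triv.
Qed.

End integer_events.

(** The fibers of [X] partition the space and [X] is constant on each. *)
Lemma expectation_nat d (T : measurableType d) (R : realType)
  (P : probability T R) (X : {RV P >-> nat}) :
  ('E_P[fun t => (X t)%:R] =
   \sum_(0 <= i <oo) i%:R%:E * P [set t | X t = i])%E.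
Proof.
have mX i : measurable [set t | X t = i].
  exact: (measurable_funPTI X (Y := [set i])).
have XT : \bigcup_i [set t | X t = i] = setT.
  by apply/seteqP; split => // t _; exists (X t).
rewrite expectation.unlock -XT ge0_integral_bigcup//.
- apply: eq_eseriesr => i _.
  rewrite -integral_cst//; apply: eq_integral => t.
  by rewrite inE /= => ->.
- rewrite XT; apply/measurable_realfun.measurable_EFinP.
  have mnat : measurable_fun [set: nat] (fun n => n%:R : R) by move=> _ B _.
  exact: measurableT_comp mnat (measurable_funPT X).
- exact: trivIset_fiber.
Qed.

Theorem corollary2p7 (R : realType) (d : measure_display)
  (T : measurableType d) (P : probability T R)
  (X : {RV P >-> nat}) (lambda : R)
  (hE : ('E_P[fun t : T => (X t)%:R%R] = lambda%:E)%E)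
  (hlambda : 0 < lambda)
  (Z : {RV P >-> int})
  (hXZ : forall i : nat, (1 <= i)%N ->
    (i%:R%:E * P [set t | X t = i] =
     lambda%:E * P [set t | ((X t)%:Z + Z t = i%:Z - 1)%R])%E) :
  ((forall t : T, 0 <= Z t) ->
     ((expR (- lambda))%:E <= P [set t | X t = 0%N])%E) /\
  ((forall t : T, Z t <= 0) ->
     (P [set t | X t = 0%N] <= (expR (- lambda))%:E)%E).
Proof.
pose Y t := (X t)%:Z + Z t.
(* Every event about the pair [(X, Z)] is a countable union over the values
   of [X]. *)
have mXZ (A : nat -> int -> Prop) : measurable [set t | A (X t) (Z t)].
  have -> : [set t | A (X t) (Z t)] =
      \bigcup_n (X @^-1` [set n] `&` Z @^-1` [set z | A n z]).
    by apply/seteqP; split => [t Xt|t [n _ [/= -> //]]]; exists (X t).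
  by apply: bigcupT_measurable => n; apply: measurableI; exact: measurable_funPTI.
have mX (k : int) : measurable [set t | (X t)%:Z = k].
  exact: (mXZ (fun n _ => n%:Z = k)).
have mY (k : int) : measurable [set t | Y t = k].
  exact: (mXZ (fun n z => n%:Z + z = k)).
have XE (i : nat) : [set t | X t = i] = [set t | (X t)%:Z = i%:Z].
  by apply/seteqP; split => t /= => [->//|[]].
have XZ (i : nat) : (i.+1%:R%:E * P [set t | X t = i.+1] =
    lambda%:E * P [set t | Y t = i%:Z])%E.
  rewrite hXZ//; congr (_ * P _)%E.
  by apply/seteqP; split => t /=; rewrite /Y; lia.
have mY_ge0 : measurable [set t | 0 <= Y t].
  exact: (mXZ (fun n z => 0 <= n%:Z + z)).
(* [lambda = E X] is the sum of the [i.+1 p i.+1], that is of the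
   [lambda q i]. *)
have Y_ge0 : P [set t | 0 <= Y t] = 1%E.
  apply/eqP; rewrite eq_le probability_le1//=.
  rewrite -(lee_pmul2l _ (_ : 0 < lambda%:E)%E)// mule1 -[leLHS]hE.
  rewrite expectation_nat nneseries_recl; last 2 first.
  - by move=> i _; rewrite mule_ge0// lee_fin.
  - by [].
  rewrite mul0e add0e.
  rewrite -(nneseries_addn (f := fun i => i%:R%:E * P [set t | X t = i])%E 1%N); last first.
    by move=> i; rewrite mule_ge0// lee_fin.
  under eq_eseriesr do rewrite addn1 XZ.
  by rewrite nneseriesZl// series_prob_eq.
pose p i := fine (P [set t | (X t)%:Z = i%:Z]).
pose q i := fine (P [set t | Y t = i%:Z]).
have pq i : i.+1%:R * p i.+1 = lambda * q i.
  by apply: EFin_inj; rewrite !EFinM !fineK ?fin_num_measure// -XZ XE.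
have p_ge0 i : 0 <= p i by exact: fine_ge0.
have p_sum1 : (fun n => \sum_(i < n) p i) @ \oo --> (1 : R).
  apply: (cvg_sum_prob_eq _ _ _ P (fun t => (X t)%:Z)) => //.
  by rewrite -(probability_setT P); congr (P _); apply/seteqP; split.
have p0E : P [set t | X t = 0%N] = (p 0%N)%:E.
  by rewrite /p fineK ?XE// fin_num_measure.
have mX_lt (n : nat) : measurable [set t | 0 <= (X t)%:Z < n%:Z].
  exact: (mXZ (fun m _ => 0 <= m%:Z < n%:Z)).
have mY_lt (n : nat) : measurable [set t | 0 <= Y t < n%:Z].
  exact: (mXZ (fun m z => 0 <= m%:Z + z < n%:Z)).
rewrite !p0E; split => Z0; rewrite lee_fin.
- apply: (expRN_le_pmf0 _ _ _ _ hlambda p_ge0 pq p_sum1) => n.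
  rewrite !sum_prob_eq// fine_le ?fin_num_measure// le_measure ?inE//.
  by move=> t /=; have := Z0 t; rewrite /Y; lia.
- apply: (pmf0_le_expRN _ _ _ _ hlambda p_ge0 pq p_sum1) => n.
  (* [X < n] forces [X + Z < n], but the sum of the [q i] for [i < n] counts
     only the nonnegative values of [X + Z]: the negative ones are null. *)
  have Y_lt0 : P (~` [set t | 0 <= Y t]) = 0%E.
    by rewrite probability_setC// Y_ge0 subee.
  have mY_lt0 := measurableC mY_ge0.
  rewrite !sum_prob_eq// fine_le ?fin_num_measure//.
  rewrite -(measureU0 (mY_lt n) mY_lt0 Y_lt0) le_measure ?inE//.
    exact: measurableU.
  move=> t /=; have [Yt|Yt] := boolP (0 <= Y t); last by right; apply/negP.
  by left; move: Yt; have := Z0 t; rewrite /Y; lia.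
Qed.
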